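(* The Cut rule is admissible in the sequent calculus $\mathsf{G3iSL}_\Box$. That is, for all finite multisets $\Gamma_1,\Gamma_2$ of formulas, every formula $\varphi$ and every multiset $\Delta$ containing at most one formula: if $\Gamma_1\Rightarrow\varphi$ and $\varphi,\Gamma_2\Rightarrow\Delta$ are both derivable in $\mathsf{G3iSL}_\Box$, then $\Gamma_1,\Gamma_2\Rightarrow\Delta$ is derivable in $\mathsf{G3iSL}_\Box$.
   Context: Formulas are built from the constant $\bot$, atoms (propositional variables) $p,q,r,\dots$, binary connectives $\wedge,\vee,\to$ and the unary modal operator $\Box$ (there is no $\Diamond$); $\neg\varphi$ abbreviates $\varphi\to\bot$; $\bot$ is not an atom. A sequent is an expression $\Gamma\Rightarrow\Delta$ with $\Gamma,\Delta$ finite multisets of formulas, $\Delta$ containing at most one formula. $\Gamma,\Pi$ denotes multiset union (multiplicities add). $\Box\Gamma$ is the multiset $\{\Box\varphi\mid\varphi\in\Gamma\}$ and $\boxdot\Gamma=\Gamma\cup\Box\Gamma$ (multiset union). A formula is boxed if it has the form $\Box\psi$. The calculus $\mathsf{G3iSL}_\Box$ has the following axioms and rules (''from premises infer conclusion''), for the modal language: At: $\Gamma,p\Rightarrow p$ ($p$ an atom). $L\bot$: $\Gamma,\bot\Rightarrow\Delta$. $R\wedge$: from $\Gamma\Rightarrow\varphi$ and $\Gamma\Rightarrow\psi$ infer $\Gamma\Rightarrow\varphi\wedge\psi$. $L\wedge$: from $\Gamma,\varphi,\psi\Rightarrow\Delta$ infer $\Gamma,\varphi\wedge\psi\Rightarrow\Delta$.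 $R\vee$: from $\Gamma\Rightarrow\varphi_i$ ($i=0$ or $1$) infer $\Gamma\Rightarrow\varphi_0\vee\varphi_1$. $L\vee$: from $\Gamma,\varphi\Rightarrow\Delta$ and $\Gamma,\psi\Rightarrow\Delta$ infer $\Gamma,\varphi\vee\psi\Rightarrow\Delta$. $R{\to}$: from $\Gamma,\varphi\Rightarrow\psi$ infer $\Gamma\Rightarrow\varphi\to\psi$. $L{\to}$: from $\Gamma,\varphi\to\psi\Rightarrow\varphi$ and $\Gamma,\psi\Rightarrow\Delta$ infer $\Gamma,\varphi\to\psi\Rightarrow\Delta$. $\mathcal R_{\rm SL}$: from $\Pi,\boxdot\Gamma,\Box\varphi\Rightarrow\varphi$ infer $\Box\Sigma,\Pi,\Box\Gamma\Rightarrow\Box\varphi$, where $\Pi$ contains no boxed formulas ($\Sigma,\Gamma$ arbitrary). *)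

(* Defs.v *)
From HB Require Import structures.
From mathcomp Require Import all_boot finmap multiset.

Set Implicit Arguments.
Unset Strict Implicit.
Unset Printing Implicit Defensive.

Local Open Scope mset_scope.

Inductive form : Type :=
  | Bot
  | Atom of nat
  | And of form & form
  | Or of form & form
  | Imp of form & form
  | Box of form.

(* Multisets [{mset T}] need a [choiceType]: [form] gets its instances by an
   encoding into generic trees. *)
Fixpoint form_encode (f : form) : GenTree.tree nat :=
  match f with
  | Bot => GenTree.Node 0 [::]
  | Atom p => GenTree.Leaf p
  | And f g => GenTree.Node 1 [:: form_encode f; form_encode g]
  | Or f g => GenTree.Node 2 [:: form_encode f; form_encode g]
  | Imp f g => GenTree.Node 3 [:: form_encode f; form_encode g]
  | Box f => GenTree.Node 4 [:: form_encode f]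
  end.

Fixpoint form_decode (t : GenTree.tree nat) : form :=
  match t with
  | GenTree.Leaf p => Atom p
  | GenTree.Node 1 [:: t; u] => And (form_decode t) (form_decode u)
  | GenTree.Node 2 [:: t; u] => Or (form_decode t) (form_decode u)
  | GenTree.Node 3 [:: t; u] => Imp (form_decode t) (form_decode u)
  | GenTree.Node 4 [:: t] => Box (form_decode t)
  | _ => Bot
  end.

Lemma form_encodeK : cancel form_encode form_decode.
Proof. by elim=> //= [f -> g ->|f -> g ->|f -> g ->|f ->]. Qed.

HB.instance Definition _ := Countable.copy form (can_type form_encodeK).

Definition boxed (f : form) : bool := if f is Box _ then true else false.

Definition boxm (G : {mset form}) : {mset form} :=
  seq_mset [seq Box f | f <- G].

Definition boxdotm (G : {mset form}) : {mset form} := G `+` boxm G.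

(* [G3iSLBox G D] is derivability of the sequent [G => D]. The succedent, a
   multiset containing at most one formula, is an [option form]. *)
Inductive G3iSLBox : {mset form} -> option form -> Prop :=
  | At G p :
      G3iSLBox (G `+` [mset Atom p]) (Some (Atom p))
  | LBot G D :
      G3iSLBox (G `+` [mset Bot]) D
  | RAnd G f g :
      G3iSLBox G (Some f) -> G3iSLBox G (Some g) ->
      G3iSLBox G (Some (And f g))
  | LAnd G f g D :
      G3iSLBox (G `+` [mset f] `+` [mset g]) D ->
      G3iSLBox (G `+` [mset And f g]) D
  | ROr0 G f g :
      G3iSLBox G (Some f) ->
      G3iSLBox G (Some (Or f g))
  | ROr1 G f g :
      G3iSLBox G (Some g) ->
      G3iSLBox G (Some (Or f g))
  | LOr G f g D :
      G3iSLBox (G `+` [mset f]) D -> G3iSLBox (G `+` [mset g]) D ->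
      G3iSLBox (G `+` [mset Or f g]) D
  | RImp G f g :
      G3iSLBox (G `+` [mset f]) (Some g) ->
      G3iSLBox G (Some (Imp f g))
  | LImp G f g D :
      G3iSLBox (G `+` [mset Imp f g]) (Some f) ->
      G3iSLBox (G `+` [mset g]) D ->
      G3iSLBox (G `+` [mset Imp f g]) D
  | RSL (S P G : {mset form}) (f : form) :
      {in P, forall g, ~~ boxed g} ->
      G3iSLBox (P `+` boxdotm G `+` [mset Box f]) (Some f) ->
      G3iSLBox (boxm S `+` P `+` boxm G) (Some (Box f)).

(* Main.v *)
(* Derivations are moved to a calculus whose antecedents are lists read as sets
   and whose left rules keep their principal formula, so that weakening and
   contraction are free. There cut is eliminated by induction on the cut
   formula, then on the number of boxed formulas (among those introduced on the right in
   the two given derivations) missing from the antecedent, then on the right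
   derivation. The second component handles the cuts on [Box f] created by the
   diagonal formula: they take place in an antecedent that has gained a new
   [Box g]. Going back requires no contraction in G3iSL: it suffices that the
   formulas of the list either occur in the multiset or have already been
   replaced there by their active subformulas. *)
Require Import Defs.
From mathcomp Require Import all_boot finmap multiset.

Local Open Scope mset_scope.

(** * The cumulative calculus on lists *)

Definition unbox (L : seq form) : seq form :=
  pmap (fun f => if f is Box g then Some g else None) L.

Lemma mem_unbox L f : (f \in unbox L) = (Box f \in L).
Proof.
elim: L => //= h L IH; rewrite inE -IH.
case: h => [|p|g k|g k|g k|g] //=; rewrite inE.
by congr (_ || _); apply/eqP/eqP => [->|[]].
Qed.

Lemma sub_cons2 (T : eqType) (x : T) (s t : seq T) :
  {subset s <= t} -> {subset x :: s <= x :: t}.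
Proof. by move=> st y; rewrite !inE => /orP[->|/st ->] //; rewrite orbT. Qed.

Lemma sub_consW2 (T : eqType) (x y : T) (s : seq T) :
  {subset s <= [:: x, y & s]}.
Proof. by move=> z zs; rewrite !inE zs !orbT. Qed.

Lemma sub_unbox (s t : seq form) :
  {subset s <= t} -> {subset unbox s ++ s <= unbox t ++ t}.
Proof.
move=> st y; rewrite !mem_cat !mem_unbox => /orP[/st ->//|/st ->].
by rewrite orbT.
Qed.

(* The finite list [U] of boxed formulas that may be introduced on the right
   makes [missing] below a measure without a subformula property. *)
Inductive cumul (U : seq form) : seq form -> option form -> Prop :=
  | CId L f : f \in L -> cumul U L (Some f)
  | CBot L D : Bot \in L -> cumul U L D
  | CRAnd L f g :
      cumul U L (Some f) -> cumul U L (Some g) -> cumul U L (Some (And f g))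
  | CLAnd L f g D :
      And f g \in L -> cumul U [:: f, g & L] D -> cumul U L D
  | CROr0 L f g : cumul U L (Some f) -> cumul U L (Some (Or f g))
  | CROr1 L f g : cumul U L (Some g) -> cumul U L (Some (Or f g))
  | CLOr L f g D :
      Or f g \in L -> cumul U (f :: L) D -> cumul U (g :: L) D -> cumul U L D
  | CRImp L f g : cumul U (f :: L) (Some g) -> cumul U L (Some (Imp f g))
  | CLImp L f g D :
      Imp f g \in L -> cumul U L (Some f) -> cumul U (g :: L) D -> cumul U L D
  | CRBox L f :
      Box f \in U -> cumul U (Box f :: unbox L ++ L) (Some f) ->
      cumul U L (Some (Box f)).

Lemma cumul_sub U U' L L' D : {subset U <= U'} -> {subset L <= L'} ->
  cumul U L D -> cumul U' L' D.
Proof.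
move=> UU' LL' d; elim: d L' LL' => {L D} [L f fL|L D bL|L f g _ IH1 _ IH2|
  L f g D fgL _ IH|L f g _ IH|L f g _ IH|L f g D fgL _ IH1 _ IH2|L f g _ IH|
  L f g D fgL _ IH1 _ IH2|L f fU _ IH] L' LL'.
- exact/CId/LL'.
- exact/CBot/LL'.
- by apply: CRAnd; [apply: IH1|apply: IH2].
- by apply: (CLAnd _ _ f g); [apply: LL'|apply/IH/sub_cons2/sub_cons2].
- exact/CROr0/IH.
- exact/CROr1/IH.
- apply: (CLOr _ _ f g); first exact: LL'.
  + exact/IH1/sub_cons2.
  + exact/IH2/sub_cons2.
- exact/CRImp/IH/sub_cons2.
- apply: (CLImp _ _ f g); first exact: LL'.
  + exact: IH1.
  + exact/IH2/sub_cons2.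
- by apply: CRBox; [apply: UU'|apply/IH/sub_cons2/sub_unbox].
Qed.

Lemma cumul_weak U L L' D : {subset L <= L'} -> cumul U L D -> cumul U L' D.
Proof. exact: cumul_sub. Qed.

(** The ways in which a derivation of [f] can end in the identity axiom or in a right rule, with the
    premises of that rule. *)
Definition introduced (U L : seq form) (f : form) : Prop :=
  f \in L \/
  match f with
  | And g h => cumul U L (Some g) /\ cumul U L (Some h)
  | Or g h => cumul U L (Some g) \/ cumul U L (Some h)
  | Imp g h => cumul U (g :: L) (Some h)
  | Box g => cumul U (Box g :: unbox L ++ L) (Some g)
  | _ => False
  end.

Lemma sub_behead (T : eqType) (x : T) (s t : seq T) :
  {subset x :: s <= t} -> {subset s <= t}.
Proof. by move=> st y ys; apply: st; rewrite inE ys orbT. Qed.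

(* The left rules closing a derivation of [L => f] permute below any rule
   that would consume [f]. *)
Lemma cumul_introduced U L f D : cumul U L (Some f) ->
  (forall L', {subset L <= L'} -> introduced U L' f -> cumul U L' D) ->
  cumul U L D.
Proof.
move=> d; move: {-1}(Some f) (erefl (Some f)) d => E defE d.
elim: d f defE => {L E} [L h hL|L E bL|L g h d1 _ d2 _|
  L g h E ghL _ IH|L g h d _|L g h d _|L g h E ghL _ IH1 _ IH2|L g h d _|
  L g h E ghL d1 _ _ IH2|L h hU d _] f defE H.
- by case: defE => -> in H *; apply: H => //; left.
- exact: CBot.
- by case: defE => -> in H *; apply: H => //; right.
- apply: (CLAnd _ _ g h) => //; apply: (IH f) => // L' /sub_behead/sub_behead.
  exact: H.
- by case: defE => -> in H *; apply: H => //; right; left.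
- by case: defE => -> in H *; apply: H => //; right; right.
- apply: (CLOr _ _ g h) => //.
  + by apply: (IH1 f) => // L' /sub_behead; exact: H.
  + by apply: (IH2 f) => // L' /sub_behead; exact: H.
- by case: defE => -> in H *; apply: H => //; right.
(* Only the right premise has succedent [f]; the left one is reused as it stands. *)
- apply: (CLImp _ _ g h) => //.
  by apply: (IH2 f) => // L' /sub_behead; exact: H.
- by case: defE => -> in H *; apply: H => //; right.
Qed.

(** * Cut elimination in the cumulative calculus *)

Definition missing (U L : seq form) : nat := count [predC L] U.

Lemma missing_sub U L L' : {subset L <= L'} -> missing U L' <= missing U L.
Proof. by move=> LL'; apply: sub_count => x; apply: contra; exact: LL'. Qed.

(** One occurrence of [f] in [U] is counted for [L] but not for [L']; the other entries of [U] are
    compared by inclusion. *)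
Lemma missing_lt U L L' f : {subset L <= L'} -> f \in U -> f \notin L ->
  f \in L' -> missing U L' < missing U L.
Proof.
move=> LL' fU fL fL'; rewrite /missing !(permP (perm_to_rem fU)) /= fL fL' /=.
by rewrite add0n add1n ltnS; apply: missing_sub.
Qed.

(** Context-sharing cut. The conclusion has the same [U] as the premises, so [missing U] can be
    compared across successive cuts. *)
Definition cut_for (U : seq form) (f : form) (L : seq form) : Prop :=
  forall D, cumul U L (Some f) -> cumul U (f :: L) D -> cumul U L D.

Lemma sub_cons (T : eqType) (x : T) (s : seq T) : {subset s <= x :: s}.
Proof. by move=> y ys; rewrite inE ys orbT. Qed.

(** Principal case: once [cumul_introduced] exposes the right rule, two cuts on the conjuncts
    suffice; if the conjunction is already in the antecedent, the left rule applies directly. *)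
Lemma cut_and U f g L D : (forall L', cut_for U f L') ->
  (forall L', cut_for U g L') -> cumul U L (Some (And f g)) ->
  cumul U [:: f, g & L] D -> cumul U L D.
Proof.
move=> cutf cutg d1 d2; apply: cumul_introduced d1 _ => L' LL' [fgL|[df dg]].
  by apply: CLAnd fgL _; apply: cumul_weak d2; do 2!apply: sub_cons2.
apply: cutg dg _; apply: cutf.
  exact: cumul_weak (@sub_cons _ _ _) df.
by apply: cumul_weak d2; do 2!apply: sub_cons2.
Qed.

Lemma cut_or U f g L D : (forall L', cut_for U f L') ->
  (forall L', cut_for U g L') -> cumul U L (Some (Or f g)) ->
  cumul U (f :: L) D -> cumul U (g :: L) D -> cumul U L D.
Proof.
move=> cutf cutg d1 d2 d3; apply: cumul_introduced d1 _ => L' LL'.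
have {}d2 : cumul U (f :: L') D by apply: cumul_weak d2; apply: sub_cons2.
have {}d3 : cumul U (g :: L') D by apply: cumul_weak d3; apply: sub_cons2.
case=> [fgL|[df|dg]]; [exact: CLOr fgL _ _|exact: cutf df _|exact: cutg dg _].
Qed.

Lemma cut_imp U f g L D : (forall L', cut_for U f L') ->
  (forall L', cut_for U g L') -> cumul U L (Some (Imp f g)) ->
  cumul U L (Some f) -> cumul U (g :: L) D -> cumul U L D.
Proof.
move=> cutf cutg d1 d2 d3; apply: cumul_introduced d1 _ => L' LL'.
have {}d2 : cumul U L' (Some f) by apply: cumul_weak d2.
have {}d3 : cumul U (g :: L') D by apply: cumul_weak d3; apply: sub_cons2.
case=> [fgL|dfg]; first exact: CLImp fgL _ _.
by apply: cutg d3; apply: cutf dfg.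
Qed.

(* If [Box g] is not yet in the antecedent, it is gained in the premise of the
   rule introducing it, so both cuts on [Box f] have fewer missing formulas. *)
Lemma cut_box U f g L : (forall L', cut_for U f L') ->
  (forall L', missing U L' < missing U L -> cut_for U (Box f) L') ->
  Box g \in U -> cumul U L (Some (Box f)) ->
  cumul U (Box g :: unbox (Box f :: L) ++ Box f :: L) (Some g) ->
  cumul U L (Some (Box g)).
Proof.
move=> cutf cutb gU d1 d2; apply: cumul_introduced (d1) _ => L' LL'.
have [gL' _|gL'] := boolP (Box g \in L'); first exact: CId.
case=> [fL'|df].
  apply: CRBox => //; apply: cumul_weak d2; apply/sub_cons2/sub_unbox => y.
  by rewrite inE => /orP[/eqP->//|/LL'].
apply: CRBox => //.
set K := Box g :: unbox L' ++ L'.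
have L'K : {subset L' <= K} by move=> y yL'; rewrite inE mem_cat yL' !orbT.
have LK : {subset L <= K} by move=> y /LL'; apply: L'K.
have ltK : missing U K < missing U L.
  apply: leq_trans (missing_sub _ _ _ LL').
  by apply: missing_lt (L'K) gU gL' _; rewrite inE eqxx.
have subK (K' : seq form) : {subset K <= K'} -> cut_for U (Box f) K'.
  by move=> KK'; apply: cutb; apply: leq_ltn_trans ltK; apply: missing_sub.
(* The premise [df] still has the diagonal formula [Box f]; a cut on it in [K] leaves [f]. *)
have dK : cumul U K (Some f).
  apply: (subK) => //; first exact: cumul_weak d1.
  by apply: cumul_weak df; apply/sub_cons2/sub_cons.
(* The formula [f] comes from unboxing [Box f] in [d2]. A second cut on [Box f], now in [f :: K],
   precedes the cut on the smaller formula [f]. *)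
apply: cutf dK _; apply: (subK); first exact: sub_cons.
  by apply: cumul_weak d1 => y /LK; exact: sub_cons.
apply: cumul_weak d2 => y; rewrite /K /= !(inE, mem_cat) !mem_unbox.
case/or4P=> [->|->|/LL'->|/orP[->|/LL'->]]; by rewrite ?orbT.
Qed.

(** The hypothesis of the outer induction, on the cut formula. *)
Definition cut_subforms (U : seq form) (f : form) : Prop :=
  match f with
  | And g h | Or g h | Imp g h =>
    (forall L, cut_for U g L) /\ (forall L, cut_for U h L)
  | Box g => forall L, cut_for U g L
  | _ => True
  end.

Lemma sub_consCA (T : eqType) (x y : T) (s t : seq T) :
  {subset s <= x :: t} -> {subset y :: s <= [:: x, y & t]}.
Proof.
move=> st z; rewrite !inE => /orP[->|/st]; first by rewrite orbT.
by rewrite inE => /orP[->|->]; rewrite ?orbT.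
Qed.

(** Innermost induction, on the right derivation. Its antecedent [K] is only included in [f :: L],
    which absorbs the exchanges caused by active formulas put in front of [f]. *)
Lemma cut_step U f n K D : cut_subforms U f ->
  (forall L, missing U L < n -> cut_for U f L) -> cumul U K D ->
  forall L, {subset K <= f :: L} -> missing U L <= n ->
    cumul U L (Some f) -> cumul U L D.
Proof.
move=> subcut cutlt; elim=> {K D} [K h hK|K D bK|K g h _ IH1 _ IH2|
  K g h D ghK _ IH|K g h _ IH|K g h _ IH|K g h D ghK _ IH1 _ IH2|K g h _ IH|
  K g h D ghK _ IH1 _ IH2|K g gU d IH] L KL leL d1.
- by move: (KL _ hK); rewrite inE => /orP[/eqP->//|]; apply: CId.
- move: (KL _ bK); rewrite inE => /orP[/eqP fE|]; last exact: CBot.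
  by subst f; apply: cumul_introduced d1 _ => L' _ [/CBot|[]].
- by apply: CRAnd; [apply: IH1|apply: IH2].
- have dL : cumul U [:: g, h & L] D.
    apply: IH; [exact/sub_consCA/sub_consCA| |].
      by apply: leq_trans leL; apply/missing_sub/sub_consW2.
    by apply: cumul_weak d1; apply: sub_consW2.
  move: (KL _ ghK); rewrite inE => /orP[/eqP fE|ghL]; last exact: CLAnd ghL dL.
  by subst f; case: subcut => cutg cuth; apply: cut_and dL.
- exact/CROr0/IH.
- exact/CROr1/IH.
- have dL k : ({subset k :: K <= [:: f, k & L]} -> missing U (k :: L) <= n ->
      cumul U (k :: L) (Some f) -> cumul U (k :: L) D) -> cumul U (k :: L) D.
    apply; first exact: sub_consCA.
      by apply: leq_trans leL; apply/missing_sub/sub_cons.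
    by apply: cumul_weak d1; apply: sub_cons.
  move: (dL _ (IH1 _)) (dL _ (IH2 _)) => {dL IH1 IH2} dL1 dL2.
  move: (KL _ ghK); rewrite inE => /orP[/eqP fE|ghL].
    by subst f; case: subcut => cutg cuth; apply: cut_or dL2.
  exact: CLOr ghL dL1 dL2.
- apply/CRImp/IH; first exact: sub_consCA.
    by apply: leq_trans leL; apply/missing_sub/sub_cons.
  by apply: cumul_weak d1; apply: sub_cons.
- have dL1 : cumul U L (Some g) by apply: IH1.
  have dL2 : cumul U (h :: L) D.
    apply: IH2; first exact: sub_consCA.
      by apply: leq_trans leL; apply/missing_sub/sub_cons.
    by apply: cumul_weak d1; apply: sub_cons.
  move: (KL _ ghK); rewrite inE => /orP[/eqP fE|ghL].
    by subst f; case: subcut => cutg cuth; apply: cut_imp dL2.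
  exact: CLImp ghL dL1 dL2.
- have {}d : cumul U (Box g :: unbox (f :: L) ++ f :: L) (Some g).
    by apply: cumul_weak d; apply/sub_cons2/sub_unbox.
  (* If [f] is not boxed, unboxing [f :: L] yields nothing from [f], and the cut moves into the
     premise. *)
  have [bf|nbf] := boolP (boxed f).
    case: f bf KL subcut cutlt d1 d {IH} => // f _ KL cutf cutlt d1 d.
    apply: cut_box d => // L' ltL'; apply: cutlt; exact: leq_trans leL.
  have LL' : {subset L <= Box g :: unbox L ++ L}.
    by move=> y yL; rewrite inE mem_cat yL !orbT.
  apply: CRBox => //; apply: IH.
  + apply: sub_consCA => y /(sub_unbox _ _ KL); rewrite inE !mem_cat !mem_unbox.
    rewrite !inE => /or3P[/orP[/eqP fE|->]|->|->]; rewrite ?orbT //.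
    by rewrite -fE in nbf.
  + by apply: leq_trans leL; apply: missing_sub.
  + exact: cumul_weak d1.
Qed.

Lemma cumul_cut U f L : cut_for U f L.
Proof.
elim: f L => [|p|f IHf g IHg|f IHf g IHg|f IHf g IHg|f IHf] L.
(* Strong induction on [missing U L], through a strict upper bound. *)
1-6: have [n] := ubnP (missing U L); elim: n L => // n IHn L ltLn D d1 d2;
  exact: (cut_step _ _ n _ _ _ IHn d2).
Qed.

(** * From lists back to multiset sequents *)

Lemma mem_boxm f G : (Box f \in boxm G) = (f \in G).
Proof.
rewrite (perm_mem (perm_eq_seq_mset _)) mem_map //.
by move=> ? ? [].
Qed.

Lemma boxm0 : boxm mset0 = mset0.
Proof. by apply/msetP => f; rewrite mset_seqE enum_mset0 mset0E. Qed.

Lemma mset_boxed_split (M : {mset form}) :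
  exists P G, [/\ {in P, forall g, ~~ boxed g} & M = P `+` boxm G].
Proof.
exists (seq_mset [seq f <- M | ~~ boxed f]), (seq_mset (unbox M)); split.
  by move=> g; rewrite (perm_mem (perm_eq_seq_mset _)) mem_filter => /andP[].
have -> : boxm (seq_mset (unbox M)) = seq_mset [seq f <- M | boxed f].
  apply/eq_seq_msetP; apply: perm_trans (perm_map _ (perm_eq_seq_mset _)) _.
  have -> : [seq Box f | f <- unbox M] = [seq f <- M | boxed f] => //.
  by elim: (M : seq form) => //= -[|p|g h|g h|g h|g] s IH //=; congr (_ :: _).
apply/msetP => f; rewrite msetE2 !mset_seqE -count_cat -count_mem_mset.
apply/permP; rewrite perm_sym perm_catC; exact/permPl/perm_filterC.
Qed.

Lemma mset_rem (M : {mset form}) f : f \in M -> exists M', M = M' `+` [mset f].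
Proof. by move=> fM; exists (M `\ f); rewrite msetDC msetB1K. Qed.

(* [covers M f]: [f] is in [M], or was in it before being replaced by its
   active formulas in premises of left rules. *)
Fixpoint covers (M : {mset form}) (f : form) : bool :=
  (f \in M) || match f with
  | And g h => covers M g && covers M h
  | Or g h => covers M g || covers M h
  | Imp g h => covers M h
  | _ => false
  end.

Lemma covers_mem M f : f \in M -> covers M f.
Proof. by case: f => [|p|g h|g h|g h|g] /= ->. Qed.

Lemma covers_sub M N f :
  (forall g, g \in M -> covers N g) -> covers M f -> covers N f.
Proof.
move=> MN; elim: f => [|p|g IHg h IHh|g IHg h IHh|g IHg h IHh|g IHg] /=;
  case/orP => [/MN //|] //.
- by case/andP => /IHg -> /IHh ->; rewrite orbT.
- by case/orP => [/IHg ->|/IHh ->]; rewrite !orbT.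
- by move/IHh ->; rewrite orbT.
Qed.

Lemma covers_Box M f : covers M (Box f) = (Box f \in M).
Proof. by rewrite /= orbF. Qed.

Lemma covers_D M N f : covers M f -> covers (M `+` N) f.
Proof.
by apply: covers_sub => g gM; apply: covers_mem; rewrite in_msetD gM.
Qed.

Lemma covers_D1 M f : covers (M `+` [mset f]) f.
Proof. by apply: covers_mem; rewrite !in_msetE eqxx orbT. Qed.

(** Meant for [f] principal in a left rule with context [M], and [N] the antecedent of a premise:
    coverage passes from conclusion to premise. *)
Lemma covers_replace M N f g : covers N f ->
  (forall h, h \in M -> covers N h) ->
  covers (M `+` [mset f]) g -> covers N g.
Proof.
move=> Nf MN; apply: covers_sub => h; rewrite !in_msetE.
by case/orP => [/MN|/eqP ->].
Qed.

(** Hides the splitting of [M] required by [RSL]: [N] stands for the antecedent of the premise. *)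
Lemma G3iSLBox_box M f :
  (forall N, {subset M <= N} -> (forall g, Box g \in M -> g \in N) ->
    Box f \in N -> G3iSLBox N (Some f)) ->
  G3iSLBox M (Some (Box f)).
Proof.
have [P [G [Pnb ->]]] := mset_boxed_split M => H.
(* The weakened part [S] is taken empty, so that every boxed formula of [M] is kept and unboxed. *)
rewrite -(msetD0 P) (msetDC P) -{1}boxm0; apply: RSL => //.
apply: H => [g|g|]; rewrite !in_msetD ?in_msetE.
- by case/orP => ->; rewrite ?orbT.
- by case/orP => [/Pnb//|]; rewrite mem_boxm => ->; rewrite ?orbT.
- by rewrite eqxx orbT.
Qed.

(** Generalized identity: a formula already replaced in [M] is rebuilt by its right rule. *)
Lemma G3iSLBox_covers M f : covers M f -> G3iSLBox M (Some f).
Proof.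
elim: f M => [|p|g IHg h IHh|g IHg h IHh|g IHg h IHh|g IHg] M /=.
- by rewrite orbF => /mset_rem[M' ->]; apply: LBot.
- by rewrite orbF => /mset_rem[M' ->]; apply: At.
- case/orP => [/mset_rem[M' ->]|/andP[/IHg dg /IHh dh]]; last exact: RAnd.
  apply: LAnd; apply: RAnd; [apply/IHg/covers_D|apply/IHh]; exact: covers_D1.
- case/orP => [/mset_rem[M' ->]|/orP[/IHg|/IHh]]; [|exact: ROr0|exact: ROr1].
  by apply: LOr; [apply/ROr0/IHg|apply/ROr1/IHh]; exact: covers_D1.
- case/orP => [/mset_rem[M' ->]|Mh]; apply: RImp; last exact/IHh/covers_D.
  rewrite msetDAC; apply: LImp; first by rewrite msetDAC; apply/IHg/covers_D1.
  exact/IHh/covers_D1.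
- rewrite orbF => gM; apply: G3iSLBox_box => N _ MN _.
  exact/IHg/covers_mem/MN.
Qed.

Lemma cumul_G3iSLBox U L D M : cumul U L D ->
  (forall f, f \in L -> covers M f) -> G3iSLBox M D.
Proof.
move=> d; elim: d M => {L D} [L f fL|L D bL|L f g _ IH1 _ IH2|
  L f g D fgL _ IH|L f g _ IH|L f g _ IH|L f g D fgL _ IH1 _ IH2|L f g _ IH|
  L f g D fgL _ IH1 _ IH2|L f _ _ IH] M ML.
- exact/G3iSLBox_covers/ML.
- by move: (ML _ bL) => /=; rewrite orbF => /mset_rem[M' ->]; apply: LBot.
- by apply: RAnd; [apply: IH1|apply: IH2].
(* If the principal formula is in [M], the left rule is applied; otherwise its active formulas are
   already covered and the induction hypothesis applies to [M] without any rule. *)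
- case/orP: (ML _ fgL) => [/mset_rem[M' eqM]|/andP[Mf Mg]].
    rewrite {}eqM in ML *; apply: LAnd; apply: IH => h.
    have Nf := covers_D _ [mset g] _ (covers_D1 M' f).
    have Ng := covers_D1 (M' `+` [mset f]) g.
    rewrite !inE => /or3P[/eqP->|/eqP->|/ML] //; apply: covers_replace.
      by rewrite /= Nf Ng orbT.
    by move=> k kM'; do 2!apply: covers_D; apply: covers_mem.
  by apply: IH => h; rewrite !inE => /or3P[/eqP->|/eqP->|/ML].
- exact/ROr0/IH.
- exact/ROr1/IH.
- case/orP: (ML _ fgL) => [/mset_rem[M' eqM]|/orP[Mf|Mg]].
  + rewrite {}eqM in ML *.
    apply: LOr; [apply: IH1|apply: IH2] => h; rewrite inE => /orP[/eqP->|/ML];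
      do ?[exact: covers_D1]; apply: covers_replace;
      do ?[by rewrite /= covers_D1 !orbT];
      by move=> k kM'; apply/covers_D/covers_mem.
  + by apply: IH1 => h; rewrite inE => /orP[/eqP->|/ML].
  + by apply: IH2 => h; rewrite inE => /orP[/eqP->|/ML].
- apply: RImp; apply: IH => h; rewrite inE => /orP[/eqP->|/ML].
    exact: covers_D1.
  exact: covers_D.
- case/orP: (ML _ fgL) => [/mset_rem[M' eqM]|Mg].
    (* The left premise keeps the implication, so its antecedent is unchanged. *)
    rewrite {}eqM in ML *; apply: LImp; first exact: IH1.
    apply: IH2 => h; rewrite inE => /orP[/eqP->|/ML]; first exact: covers_D1.
    apply: covers_replace => [|k kM']; first by rewrite /= covers_D1 orbT.
    exact/covers_D/covers_mem.
  by apply: IH2 => h; rewrite inE => /orP[/eqP->|/ML].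
- apply: G3iSLBox_box => N MN MuN fN; apply: IH => h; rewrite inE mem_cat.
  case/or3P => [/eqP->||/ML]; first exact: covers_mem.
    rewrite mem_unbox => /ML; rewrite covers_Box => /MuN; exact: covers_mem.
  by apply: covers_sub => g /MN; apply: covers_mem.
Qed.

(** * From multiset sequents to lists, and cut for multisets *)

Lemma G3iSLBox_cumul M D : G3iSLBox M D ->
  exists U, forall L, {subset M <= L} -> cumul U L D.
Proof.
have subl (s t : seq form) : {subset s <= s ++ t}.
  by move=> x xs; rewrite mem_cat xs.
have subr (s t : seq form) : {subset t <= s ++ t}.
  by move=> x xt; rewrite mem_cat xt orbT.
have subD (M' : {mset form}) f (L : seq form) : {subset M' <= L} ->
    {subset M' `+` [mset f] <= f :: L}.
  move=> M'L x; rewrite in_msetD in_mset1 inE orbC.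
  by case/orP=> [->//|/M'L ->]; rewrite orbT.
have subI (M' : {mset form}) f (L : seq form) : {subset M' `+` [mset f] <= L} ->
    {subset M' <= L} /\ f \in L.
  move=> M'L; split=> [x xM'|]; apply: M'L; rewrite !in_msetE ?xM' //.
  by rewrite eqxx orbT.
elim=> {M D} [M p|M D|M f g _ [U1 IH1] _ [U2 IH2]|M f g D _ [U IH]|
  M f g _ [U IH]|M f g _ [U IH]|M f g D _ [U1 IH1] _ [U2 IH2]|M f g _ [U IH]|
  M f g D _ [U1 IH1] _ [U2 IH2]|S P G f Pnb _ [U IH]].
- by exists [::] => L /subI[_ pL]; apply: CId.
- by exists [::] => L /subI[_ bL]; apply: CBot.
- exists (U1 ++ U2) => L ML; apply: CRAnd.
  + exact/(cumul_sub _ _ _ _ _ (subl _ _) _ (IH1 _ ML)).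
  + exact/(cumul_sub _ _ _ _ _ (subr _ _) _ (IH2 _ ML)).
- exists U => L /subI[ML fgL]; apply: CLAnd fgL _; apply: IH => x.
  by move/(subD _ _ _ (subD _ _ _ ML)); rewrite !inE orbCA.
- by exists U => L ML; apply/CROr0/IH.
- by exists U => L ML; apply/CROr1/IH.
- exists (U1 ++ U2) => L /subI[ML fgL]; apply: CLOr fgL _ _.
  + exact/(cumul_sub _ _ _ _ _ (subl _ _) _ (IH1 _ (subD _ _ _ ML))).
  + exact/(cumul_sub _ _ _ _ _ (subr _ _) _ (IH2 _ (subD _ _ _ ML))).
- by exists U => L ML; apply/CRImp/IH/subD.
- exists (U1 ++ U2) => L MfL; have [ML fgL] := subI _ _ _ MfL.
  apply: CLImp fgL _ _.
  + exact/(cumul_sub _ _ _ _ _ (subl _ _) _ (IH1 _ MfL)).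
  + exact/(cumul_sub _ _ _ _ _ (subr _ _) _ (IH2 _ (subD _ _ _ ML))).
(* [U] collects the principal formulas of the [RSL] inferences. *)
- exists (Box f :: U) => L ML; apply: CRBox; first by rewrite inE eqxx.
  apply: (cumul_sub U); [exact: sub_cons|move=> x; exact: id|].
  apply/IH/subD => x.
  rewrite !in_msetD mem_cat mem_unbox => /or3P[xP|xG|xG].
  + by rewrite orbC ML // !in_msetD xP orbT.
  + by rewrite (ML (Box x)) // !in_msetD !mem_boxm xG orbT.
  + by rewrite orbC ML // !in_msetD xG orbT.
Qed.

Theorem theorem1 (G1 G2 : {mset form}) (f : form) (D : option form) :
  G3iSLBox G1 (Some f) ->
  G3iSLBox ([mset f] `+` G2) D ->
  G3iSLBox (G1 `+` G2) D.
Proof.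
move=> /G3iSLBox_cumul[U1 d1] /G3iSLBox_cumul[U2 d2].
(* Both derivations are weakened to the common list [U1 ++ U2] and the common context, as
   context-sharing cut requires. *)
apply: (cumul_G3iSLBox (U1 ++ U2) (G1 `+` G2)) => [|g]; last exact: covers_mem.
apply: (cumul_cut _ f).
- apply: (cumul_sub U1 _ (G1 `+` G2)) => //.
    by move=> g gU; rewrite mem_cat gU.
  by apply: d1 => g gG1; rewrite in_msetD gG1.
- apply: (cumul_sub U2 _ (f :: (G1 `+` G2))) => //.
    by move=> g gU; rewrite mem_cat gU orbT.
  apply: d2 => g; rewrite in_msetD in_mset1 inE => /orP[->//|gG2].
  by rewrite in_msetD gG2 !orbT.
Qed.
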